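(* Let $\gamma,\gamma',\rho,\varepsilon\in(0,1]$ and $m,n\in\mathbb{Z}_{>0}$. Let $\boldsymbol{u}\in\mathbb{R}_{>0}^m$, $\boldsymbol{v}\in\mathbb{R}_{>0}^n$ with $\|\boldsymbol{u}\|_1=\|\boldsymbol{v}\|_1=1$, and let $B\in\mathbb{R}_{\ge0}^{m\times n}$ be $(\gamma,\gamma',\rho)$-dense with respect to $(\boldsymbol{u},\boldsymbol{v})$. If $\gamma+\gamma'>1$, then with input $(\mathrm{diag}(\boldsymbol{u})\cdot B\cdot\mathrm{diag}(\boldsymbol{v}),(\boldsymbol{u},\boldsymbol{v}))$ the SK algorithm outputs a matrix $A$ satisfying $\|\boldsymbol{r}(A)-\boldsymbol{u}\|_1+\|\boldsymbol{c}(A)-\boldsymbol{v}\|_1\le\varepsilon$ within $$O\Bigl(\rho^{-14}(\gamma+\gamma'-1)^{-6}\bigl(-\log\varepsilon-\log\rho-\log(\gamma+\gamma'-1)\bigr)\Bigr)$$ iterations.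
   Context: SK on input $(A,(\boldsymbol{u},\boldsymbol{v}))$: $A^{(0)}_{ij}=u_iA_{ij}/r_i(A)$; odd $k$: $A^{(k)}_{ij}=v_jA^{(k-1)}_{ij}/c_j(A^{(k-1)})$; even $k\ge2$: $A^{(k)}_{ij}=u_iA^{(k-1)}_{ij}/r_i(A^{(k-1)})$, where $r_i,c_j$ are row/column sums and $\boldsymbol{r},\boldsymbol{c}$ their vectors. ''Outputs within $T$ iterations'': some $A^{(k)}$ with $k\le T$ has the property; $O$ hides an absolute constant. For nonzero $A\ge0$, $t=\max A_{ij}$: $A$ is $(\gamma,\gamma',\rho)$-dense w.r.t. $(\boldsymbol{u},\boldsymbol{v})$ if $\gamma=\min_i\sum_k v_k\mathbf{1}[A_{ik}>\rho t]/\|\boldsymbol{v}\|_1$ and $\gamma'=\min_j\sum_k u_k\mathbf{1}[A_{kj}>\rho t]/\|\boldsymbol{u}\|_1$. *)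

(* Defs.v *)
From HB Require Import structures.
From mathcomp Require Import all_boot all_order all_algebra.
From mathcomp Require Import reals exp.

Set Implicit Arguments.
Unset Strict Implicit.
Unset Printing Implicit Defensive.

Import Order.TTheory GRing.Theory Num.Theory.
Local Open Scope ring_scope.

Definition norm1 (R : realType) (n : nat) (x : 'rV[R]_n) : R :=
  \sum_(i < n) `|x ord0 i|.

(* The vectors of row sums and of column sums are both stored as row vectors,
   the format of the argument of [diag_mx]. *)
Definition row_sums (R : realType) (m n : nat) (A : 'M[R]_(m, n)) : 'rV[R]_m :=
  \row_(i < m) \sum_(j < n) A i j.

Definition col_sums (R : realType) (m n : nat) (A : 'M[R]_(m, n)) : 'rV[R]_n :=
  \row_(j < n) \sum_(i < m) A i j.

Definition row_scale (R : realType) (m n : nat) (u : 'rV[R]_m)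
    (A : 'M[R]_(m, n)) : 'M[R]_(m, n) :=
  \matrix_(i < m, j < n) (u ord0 i * A i j / row_sums A ord0 i).

Definition col_scale (R : realType) (m n : nat) (v : 'rV[R]_n)
    (A : 'M[R]_(m, n)) : 'M[R]_(m, n) :=
  \matrix_(i < m, j < n) (v ord0 j * A i j / col_sums A ord0 j).

(* Division is total ([x / 0 = 0]); for an input with no zero row or column all
   the sums divided by are positive. *)
Fixpoint SK (R : realType) (m n : nat) (A : 'M[R]_(m, n)) (u : 'rV[R]_m)
    (v : 'rV[R]_n) (k : nat) : 'M[R]_(m, n) :=
  match k with
  | 0%N => row_scale u A
  | k'.+1 => if odd k'.+1 then col_scale v (SK A u v k')
             else row_scale u (SK A u v k')
  end.

(* The base value 0 is harmless: it is only used for nonnegative [A]. *)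
Definition max_entry (R : realType) (m n : nat) (A : 'M[R]_(m, n)) : R :=
  \big[Num.max/0]_(i < m) \big[Num.max/0]_(j < n) A i j.

Definition is_min (R : realType) (m : nat) (f : 'I_m -> R) (x : R) : Prop :=
  (exists i, f i = x) /\ (forall i, x <= f i).

Definition weighted_dense (R : realType) (m n : nat) (gamma gamma' rho : R)
    (u : 'rV[R]_m) (v : 'rV[R]_n) (A : 'M[R]_(m, n)) : Prop :=
  [/\ A != 0,
      forall i j, 0 <= A i j,
      is_min (fun i : 'I_m =>
        (\sum_(k < n | rho * max_entry A < A i k) v ord0 k) / norm1 v) gamma
    & is_min (fun j : 'I_n =>
        (\sum_(k < m | rho * max_entry A < A k j) u ord0 k) / norm1 u) gamma'].

(* Main.v *)
(* Write d = gamma + gamma' - 1 and scale B so that its largest entry is 1. The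
   algorithm alternates the maps y -> 1 / (B v y) and x -> 1 / (B^T u x) on
   positive vectors, starting from y = 1.

   If x B y has marginals u and v up to a small relative error, then the sums
   X = sum u x and Y = sum v y satisfy X Y = O(1 / (rho^2 d)): a row i0 with
   x_i0 >= X forces the y-mass of the columns where it is dense to be
   O(1 / (rho X)), likewise for a column j0 with y_j0 >= Y, whereas these rows
   and columns together carry more than the total mass, by an excess of d.
   Hence the scaled matrix is at least of order rho^3 d on the dense entries.

   Such approximate scalings exist: for a positive matrix the iteration
   contracts trivially, and flooring the entries of B at a tiny positive level
   changes the marginals of the scaled matrix by little, thanks to the same
   bounds.

   Finally run the algorithm on B in the coordinates y_k / y. Its kernels are
   then almost stochastic. As one of gamma, gamma' is at least (1 + d) / 2, any
   two rows (or any two columns) share dense entries of mass at least d, so one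
   of the two kernels has Dobrushin overlap of order rho^3 d^2. The ratio
   max / min of y_k / y starts at O(1 / (rho^3 d^2)), and its distance to 1
   shrinks by the factor 1 - c rho^3 d^2 in each round. *)

Require Import Defs.
From HB Require Import structures.
From mathcomp Require Import all_boot all_order all_algebra.
From mathcomp Require Import reals sequences exp.
From mathcomp Require Import ring lra.

Set Implicit Arguments.
Unset Strict Implicit.
Unset Printing Implicit Defensive.

Import Order.TTheory GRing.Theory Num.Theory.
Local Open Scope ring_scope.

(** * Projective oscillation *)

Definition kapp (R : realType) (I J : finType) (P : I -> J -> R) (z : J -> R)
    (i : I) : R :=
  \sum_j P i j * z j.

Definition half_step (R : realType) (I J : finType) (P : I -> J -> R)
    (z : J -> R) (i : I) : R :=
  (kapp P z i)^-1.

Definition sk_round (R : realType) (I J : finType) (P : I -> J -> R)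
    (Q : J -> I -> R) (z : J -> R) : J -> R :=
  half_step Q (half_step P z).

Definition osc_le (R : realType) (J : finType) (k : R) (z : J -> R) : Prop :=
  forall j j', z j <= k * z j'.

(** For probability rows this is one minus their total variation distance. *)
Definition overlap (R : realType) (I J : finType) (P : I -> J -> R)
    (i i' : I) : R :=
  \sum_j Num.min (P i j) (P i' j).

Section Kernels.
Variables (R : realType).
Implicit Types (I J : finType).

Lemma kapp_gt0 I J (P : I -> J -> R) (z : J -> R) i :
  (forall j, 0 <= P i j) -> 0 < \sum_j P i j -> (forall j, 0 < z j) ->
  0 < kapp P z i.
Proof.
move=> P0 Ps z0; have [j Pj] : exists j, 0 < P i j.
  apply/existsP; apply: contraLR Ps; rewrite negb_exists => /forallP h.
  by rewrite -leNgt; apply: sumr_le0 => j _; rewrite leNgt.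
rewrite /kapp (bigD1 j) //= ltr_wpDr ?mulr_gt0 //.
by apply: sumr_ge0 => l _; rewrite mulr_ge0 // ltW.
Qed.

Lemma half_step_gt0 I J (P : I -> J -> R) (z : J -> R) :
  (forall i j, 0 <= P i j) -> (forall i, 0 < \sum_j P i j) ->
  (forall j, 0 < z j) -> forall i, 0 < half_step P z i.
Proof. by move=> P0 Ps z0 i; rewrite invr_gt0 kapp_gt0. Qed.

Lemma half_step_ext I J (P : I -> J -> R) (z z' : J -> R) :
  z =1 z' -> half_step P z =1 half_step P z'.
Proof.
by move=> zz i; rewrite /half_step /kapp; under eq_bigr do rewrite zz.
Qed.

Lemma half_step_rescale I J (P : I -> J -> R) (x : I -> R) (y z : J -> R) i :
  x i != 0 ->
  half_step P (fun j => y j * z j) i =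
  x i * half_step (fun i j => x i * P i j * y j) z i.
Proof.
move=> x0; rewrite /half_step /kapp.
under [in RHS]eq_bigr do rewrite -!mulrA.
by rewrite -mulr_sumr invfM mulrA divff // mul1r.
Qed.

(** Diagonal scaling conjugates a round into a round of the scaled kernels, which can be made nearly
    stochastic. Input and output may use different coordinates [y] and [y'], such as two consecutive
    iterates. *)
Lemma sk_round_rescale I J (P : I -> J -> R) (Q : J -> I -> R)
    (x : I -> R) (y y' z : J -> R) j :
  (forall i, x i != 0) -> y' j != 0 ->
  sk_round P Q (fun j => y j * z j) j =
  y' j * sk_round (fun i j => x i * P i j * y j)
                  (fun j i => y' j * Q j i * x i) z j.
Proof.
move=> x0 y0; rewrite {1}/sk_round.
rewrite (half_step_ext Q (fun i => half_step_rescale P y z (x0 i))).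
exact: half_step_rescale.
Qed.

Lemma osc_le_ext J (k : R) (z z' : J -> R) :
  z =1 z' -> osc_le k z -> osc_le k z'.
Proof. by move=> zz h j j'; rewrite -!zz. Qed.

Lemma osc_le_mono J (k k' : R) (z : J -> R) :
  (forall j, 0 < z j) -> k <= k' -> osc_le k z -> osc_le k' z.
Proof.
move=> z0 kk h j j'; apply: le_trans (h j j') _.
by rewrite ler_wpM2r // ltW.
Qed.

Lemma osc_le_inv J (k : R) (z : J -> R) :
  (forall j, 0 < z j) -> osc_le k z -> osc_le k (fun j => (z j)^-1).
Proof.
move=> z0 h j j'; rewrite -[X in X <= _]mul1r ler_pdivrMr //.
by rewrite mulrAC ler_pdivlMr // mul1r.
Qed.

Lemma osc_le_mul J (k l : R) (z w : J -> R) :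
  (forall j, 0 < z j) -> (forall j, 0 < w j) ->
  osc_le k z -> osc_le l w -> osc_le (k * l) (fun j => z j * w j).
Proof. 
by move=> z0 w0 hz hw j j'; rewrite mulrACA ler_pM // ltW.
Qed.

Lemma osc_le_exists J (z : J -> R) :
  (forall j, 0 < z j) -> exists2 c, 0 <= c & osc_le (1 + c) z.
Proof.
move=> z0; have i0 j : 0 < (z j)^-1 by rewrite invr_gt0.
exists ((\sum_j z j) * \sum_j (z j)^-1).
  by rewrite mulr_ge0 // sumr_ge0 // => j _; rewrite ltW.
move=> j j'; rewrite mulrDl mul1r ler_wpDl ?(ltW (z0 _)) //.
rewrite -[X in X <= _]mulr1 -(mulVf (lt0r_neq0 (z0 j'))) mulrA.
rewrite ler_wpM2r ?(ltW (z0 _)) //.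
apply: ler_pM; rewrite ?(ltW (z0 _)) ?(ltW (i0 _)) //.
  by rewrite (bigD1 j) //= lerDl sumr_ge0 // => l _; rewrite ltW.
by rewrite (bigD1 j') //= lerDl sumr_ge0 // => l _; rewrite ltW.
Qed.

(** A positive function of mean 1 and oscillation [k] takes values between [1 / k] and [k], and
    [1 - 1 / k <= k - 1]. *)
Lemma osc_le_near1 J (v g : J -> R) (k : R) j :
  (forall j, 0 <= v j) -> (forall j, 0 < g j) ->
  \sum_j v j = 1 -> \sum_j v j * g j = 1 -> 1 <= k ->
  osc_le k g -> `|g j - 1| <= k - 1.
Proof.
move=> v0 g0 v1 vg k1 h.
have gk : g j <= k.
  have : \sum_l v l * g j <= \sum_l k * (v l * g l).
    by apply: ler_sum => l _; rewrite mulrCA ler_wpM2l.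
  by rewrite -mulr_suml -mulr_sumr v1 vg mul1r mulr1.
have kg : 1 <= k * g j.
  have : \sum_l v l * g l <= \sum_l v l * (k * g j).
    by apply: ler_sum => l _; rewrite ler_wpM2l.
  by rewrite -mulr_suml v1 vg mul1r.
by have := g0 j; rewrite ler_norml => gj; apply/andP; split; nra.
Qed.

(* Dobrushin's contraction for the projective oscillation; [a] and [b] measure
   how far the rows of [P] are from being stochastic. *)
Lemma half_step_osc I J (P : I -> J -> R) (z : J -> R) (a b t k : R) :
  (forall i j, 0 <= P i j) -> 0 < a ->
  (forall i, a <= \sum_j P i j <= b) ->
  (forall i i', b * t <= overlap P i i') -> 0 <= t <= 1 -> 1 <= k ->
  (forall j, 0 < z j) -> osc_le k z ->
  osc_le (b / a * (1 + (1 - t) * (k - 1))) (half_step P z).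
Proof.
move=> P0 a0 Pab Pt /andP[t0 t1] k1 z0 h.
have Ps i : 0 < \sum_j P i j by have /andP[+ _] := Pab i; apply: lt_le_trans.
apply: osc_le_inv => [i|i i']; first exact: kapp_gt0.
have [j0 _] : exists j, 0 < P i j.
  apply/existsP; have := Ps i; apply: contraLR.
  rewrite negb_exists => /forallP H.
  by rewrite -leNgt; apply: sumr_le0 => j _; rewrite leNgt.
case: (arg_minP z (erefl : xpredT j0)) => jm _ zm.
set m := z jm in zm *; have m0 : 0 < m := z0 jm.
have zM j : z j <= k * m by exact: h.
(* The rows share the part [w]; only the remainders can weight [z] differently, at worst by [k * m]
   in row [i] and by [m] in row [i']. *)
pose w j := Num.min (P i j) (P i' j).
have w0 j : 0 <= w j by rewrite le_min !P0.
have wl j : w j <= P i j by rewrite ge_min lexx.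
have wr j : w j <= P i' j by rewrite ge_min lexx orbT.
have -> : kapp P z i = \sum_j w j * z j + \sum_j (P i j - w j) * z j.
  by rewrite -big_split; apply: eq_bigr => j _ /=; ring.
have -> : kapp P z i' = \sum_j w j * z j + \sum_j (P i' j - w j) * z j.
  by rewrite -big_split; apply: eq_bigr => j _ /=; ring.
have hU : \sum_j (P i j - w j) * z j <= (\sum_j P i j - \sum_j w j) * (k * m).
  rewrite -sumrB mulr_suml; apply: ler_sum => j _.
  by rewrite ler_wpM2l // subr_ge0.
have hL : (\sum_j P i' j - \sum_j w j) * m <= \sum_j (P i' j - w j) * z j.
  rewrite -sumrB mulr_suml; apply: ler_sum => j _.
  by rewrite ler_wpM2l ?subr_ge0 // zm.
have hO : (\sum_j w j) * m <= \sum_j w j * z j.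
  by rewrite mulr_suml; apply: ler_sum => j _; rewrite ler_wpM2l // zm.
have := Pt i i'; rewrite /overlap -/w => hW.
move: (Pab i) (Pab i') hU hL hO hW.
move: (\sum_j P i j) (\sum_j P i' j) (\sum_j w j) => r r' W.
move: (\sum_j (P i j - w j) * z j) (\sum_j (P i' j - w j) * z j)
  (\sum_j w j * z j) => U L O /andP[_ rb] /andP[ar _] hU hL hO hW.
set e := 1 + (1 - t) * (k - 1).
have e1 : 1 <= e by rewrite /e; nra.
have ba : a <= b by have /andP[] := Pab i; apply: le_trans.
have q1 : 1 <= b / a * e.
  have : 1 <= b / a by rewrite ler_pdivlMr // mul1r.
  nra.
have qa : b / a * e * a = b * e by field; rewrite gt_eqF.
set q := b / a * e in q1 qa *.
(* The goal is [O + U <= q * (O + L)]. By [h1], [h3] and [h4] the difference is at least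
   [q * a * m - b * k * m + W * (k - 1) * m], which is nonnegative by [h5] and [h6]. *)
have h1 : U <= (b - W) * (k * m).
  apply: le_trans hU _; rewrite ler_wpM2r ?lerB // mulr_ge0 ?(ltW m0) //.
  by lra.
have h2 : (a - W) * m <= L.
  by apply: le_trans hL; rewrite ler_wpM2r ?(ltW m0) // lerB.
have h3 : q * ((a - W) * m) <= q * L by rewrite ler_wpM2l //; lra.
have h4 : (q - 1) * (W * m) <= (q - 1) * O by rewrite ler_wpM2l // subr_ge0.
have h5 : (b * t) * ((k - 1) * m) <= W * ((k - 1) * m).
  by rewrite ler_wpM2r // mulr_ge0 ?subr_ge0 // ltW.
have h6 : q * a * m = b * (1 + (1 - t) * (k - 1)) * m by rewrite qa.
lra.
Qed.

Lemma overlap_ge0 I J (P : I -> J -> R) i i' :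
  (forall i j, 0 <= P i j) -> 0 <= overlap P i i'.
Proof. by move=> P0; apply: sumr_ge0 => j _; rewrite le_min !P0. Qed.

(** The kernel without a known overlap is treated with [t = 0], so it only costs a factor
    [b / a]. *)
Lemma sk_round_osc I J (P : I -> J -> R) (Q : J -> I -> R) (z : J -> R)
    (a b t k : R) :
  (forall i j, 0 <= P i j) -> (forall j i, 0 <= Q j i) -> 0 < a ->
  (forall i, a <= \sum_j P i j <= b) -> (forall j, a <= \sum_i Q j i <= b) ->
  (forall i i', b * t <= overlap P i i') \/
    (forall j j', b * t <= overlap Q j j') ->
  0 <= t <= 1 -> 1 <= k -> (forall j, 0 < z j) -> osc_le k z ->
  osc_le ((b / a) ^+ 2 * (1 + (1 - t) * (k - 1))) (sk_round P Q z).
Proof.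
move=> P0 Q0 a0 Pab Qab PQt t01 k1 z0 h j j'.
have Ps i : 0 < \sum_j P i j by have /andP[+ _] := Pab i; apply: lt_le_trans.
have Qs i : 0 < \sum_j Q i j by have /andP[+ _] := Qab i; apply: lt_le_trans.
have ba : 1 <= b / a.
  by rewrite ler_pdivlMr // mul1r; have /andP[] := Qab j; apply: le_trans.
have y0 := half_step_gt0 P0 Ps z0.
have yy0 := half_step_gt0 Q0 Qs y0.
have z01 : 0 <= (0 : R) <= 1 by rewrite lexx ler01.
have ov0 (A B : finType) (M : A -> B -> R) : (forall i j, 0 <= M i j) ->
    forall i i', b * 0 <= overlap M i i'.
  by move=> M0 i i'; rewrite mulr0 overlap_ge0.
have e1 : 1 <= 1 + (1 - t) * (k - 1).
  by have /andP[_ t1] := t01; rewrite lerDl mulr_ge0 ?subr_ge0.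
move: j j'; rewrite -/(osc_le _ _); case: PQt => ht.
  have h1 := half_step_osc P0 a0 Pab ht t01 k1 z0 h.
  have := half_step_osc Q0 a0 Qab (ov0 _ _ _ Q0) z01 _ y0 h1.
  have -> : b / a * (1 + (1 - 0) * (b / a * (1 + (1 - t) * (k - 1)) - 1)) =
      (b / a) ^+ 2 * (1 + (1 - t) * (k - 1)) by ring.
  by apply; nra.
have h1 := half_step_osc P0 a0 Pab (ov0 _ _ _ P0) z01 k1 z0 h.
have := half_step_osc Q0 a0 Qab ht t01 _ y0 h1.
have -> : b / a * (1 + (1 - 0) * (k - 1)) = b / a * k by ring.
move=> H; have k1' : 1 <= b / a * k by nra.
apply: osc_le_mono yy0 _ (H k1').
(* When the contracting kernel comes second, the bound obtained is smaller than the claimed one by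
   [q * (q - 1) * t]. *)
have /andP[t0 _] := t01; move: (b / a) ba => q q1.
have : 0 <= q * ((q - 1) * t) by rewrite !mulr_ge0 ?subr_ge0 //; lra.
by rewrite expr2; lra.
Qed.

End Kernels.

(** * Approximate scalings of positive matrices *)

Section Weighted.
Variables (R : realType).
Implicit Types (I J : finType).

Definition wker I J (B : I -> J -> R) (v : J -> R) (i : I) (j : J) : R :=
  B i j * v j.

Definition transp I J (B : I -> J -> R) (j : J) (i : I) : R := B i j.

(** Column multipliers relative to [v] after [k] rounds; with the row multipliers [sk_row] they
    describe the row-normalised iterates, see [SK_double]. *)
Definition sk_col I J (B : I -> J -> R) (u : I -> R) (v : J -> R) (k : nat) :
    J -> R :=
  iter k (sk_round (wker B v) (wker (transp B) u)) (fun=> 1).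

Definition sk_row I J (B : I -> J -> R) (u : I -> R) (v : J -> R) (k : nat) :
    I -> R :=
  half_step (wker B v) (sk_col B u v k).

(** The mass of the row-normalised matrix is counted by columns and by rows. *)
Lemma sk_mass I J (B : I -> J -> R) (u : I -> R) (v y : J -> R) :
  (forall i, kapp (wker B v) y i != 0) ->
  \sum_j v j * (y j * kapp (wker (transp B) u) (half_step (wker B v) y) j) =
  \sum_i u i.
Proof.
move=> ky; under eq_bigr do rewrite mulrA /kapp mulr_sumr.
rewrite exchange_big /=; apply: eq_bigr => i _.
rewrite -[RHS](mulfK (ky i)) [RHS]mulrAC.
rewrite -[_ / _]/(u i * half_step (wker B v) y i).
rewrite [in RHS]/kapp mulr_sumr; apply: eq_bigr => j _.
by rewrite /wker /transp; ring.
Qed.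

Section Positivity.
Context (I J : finType) (B : I -> J -> R) (u : I -> R) (v : J -> R).
Hypothesis B0 : forall i j, 0 <= B i j.
Hypothesis u0 : forall i, 0 < u i.
Hypothesis v0 : forall j, 0 < v j.
Hypothesis Bv : forall i, 0 < \sum_j B i j * v j.
Hypothesis Bu : forall j, 0 < \sum_i B i j * u i.

Lemma wker_ge0 i j : 0 <= wker B v i j.
Proof. by rewrite mulr_ge0 // ltW. Qed.

Lemma wkerT_ge0 j i : 0 <= wker (transp B) u j i.
Proof. exact: mulr_ge0 (B0 _ _) (ltW (u0 _)). Qed.

Lemma kapp_row_gt0 (z : J -> R) i :
  (forall j, 0 < z j) -> 0 < kapp (wker B v) z i.
Proof. by apply: kapp_gt0 (Bv i) => j; exact: wker_ge0. Qed.

Lemma kapp_col_gt0 (z : I -> R) j :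
  (forall i, 0 < z i) -> 0 < kapp (wker (transp B) u) z j.
Proof. by apply: kapp_gt0 (Bu j) => i; exact: wkerT_ge0. Qed.

Lemma sk_round_gt0 (z : J -> R) :
  (forall j, 0 < z j) ->
  forall j, 0 < sk_round (wker B v) (wker (transp B) u) z j.
Proof.
move=> z0 j; rewrite invr_gt0 kapp_col_gt0 // => i.
by rewrite invr_gt0 kapp_row_gt0.
Qed.

Lemma sk_col_gt0 k j : 0 < sk_col B u v k j.
Proof. by elim: k j => [|k IH] j; [exact: ltr01 | exact: sk_round_gt0]. Qed.

Lemma sk_row_gt0 k i : 0 < sk_row B u v k i.
Proof. by rewrite invr_gt0 kapp_row_gt0 // => j; exact: sk_col_gt0. Qed.

Lemma sk_col_marginalE k j :
  sk_col B u v k j * kapp (wker (transp B) u) (sk_row B u v k) j =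
  sk_col B u v k j * (sk_col B u v k.+1 j)^-1.
Proof. by rewrite /= /sk_round /half_step invrK. Qed.

Lemma sk_row_marginal k i :
  sk_row B u v k i * kapp (wker B v) (sk_col B u v k) i = 1.
Proof.
by rewrite mulVf // gt_eqF // kapp_row_gt0 // => j; exact: sk_col_gt0.
Qed.

(** The column marginals are ratios of consecutive iterates and have [v]-mean 1 by [sk_mass], so
    their oscillation bounds their distance to 1. *)
Lemma sk_col_marginal_near1 k j (K : R) :
  \sum_i u i = 1 -> \sum_j v j = 1 -> 1 <= K ->
  osc_le K (fun j => sk_col B u v k j * (sk_col B u v k.+1 j)^-1) ->
  `|sk_col B u v k j * kapp (wker (transp B) u) (sk_row B u v k) j - 1|
    <= K - 1.
Proof.
move=> u1 v1 K1 h.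
apply: (osc_le_near1 (v := v) 
  (g := fun j => sk_col B u v k j *
    kapp (wker (transp B) u) (sk_row B u v k) j)) => //.
- by move=> j'; exact: ltW.
- by move=> j'; rewrite sk_col_marginalE; apply: divr_gt0; exact: sk_col_gt0.
- rewrite sk_mass // => i; rewrite gt_eqF // kapp_row_gt0 //.
  exact: sk_col_gt0.
- by apply: osc_le_ext h => j'; rewrite sk_col_marginalE.
Qed.

End Positivity.

Lemma geometric_decay (t c e : R) (k : nat) :
  0 < c -> 0 < e -> t <= 1 -> ln (c / e) <= t * k%:R -> (1 - t) ^+ k * c <= e.
Proof.
move=> c0 e0 t1 hk; rewrite -ler_pdivlMr //.
have : (1 - t) ^+ k <= expR (- (t * k%:R)).
  rewrite -mulNr expRM_natr lerXn2r ?nnegrE ?subr_ge0 ?expR_ge0 //.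
  by apply: le_trans (expR_ge1Dx (- t)).
move/le_trans; apply; rewrite -[X in _ <= X]lnK ?posrE ?divr_gt0 // ler_expR.
by rewrite lerNl -lnV ?posrE ?divr_gt0 // invf_div.
Qed.

(** The error is relative and holds for each row and column separately, which gives access to single
    values [x i] and [y j]. *)
Definition approx_scaling I J (B : I -> J -> R) (u : I -> R) (v : J -> R)
    (h : R) (x : I -> R) (y : J -> R) : Prop :=
  [/\ forall i, 0 < x i, forall j, 0 < y j,
      forall i, `|x i * kapp (wker B v) y i - 1| <= h
    & forall j, `|y j * kapp (wker (transp B) u) x j - 1| <= h].

(** A late iterate of the algorithm serves: its row marginals are exact, and the oscillation of the
    ratio of consecutive iterates contracts by [1 - b] per round. *)
Lemma approx_scaling_pos I J (B : I -> J -> R) (u : I -> R) (v : J -> R)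
    (b h : R) :
  0 < b -> (forall i j, b <= B i j <= 1) ->
  (forall i, 0 < u i) -> (forall j, 0 < v j) ->
  \sum_i u i = 1 -> \sum_j v j = 1 -> 0 < h ->
  exists x, exists y, approx_scaling B u v h x y.
Proof.
move=> b0 Bb u0 v0 u1 v1 h0.
have B0 i j : 0 < B i j by have /andP[bB _] := Bb i j; exact: lt_le_trans bB.
have sum_gt0 (K : finType) (f : K -> R) : (forall k, 0 < f k) ->
    (exists k : K, true) -> 0 < \sum_k f k.
  move=> f0 [k _]; rewrite (bigD1 k) //= ltr_wpDr //.
  by apply: sumr_ge0 => l _; exact: ltW.
have exI : exists i : I, true.
  case: (pickP (@predT I)) => [i _|e]; first by exists i.
  by move: u1; rewrite big_pred0 // => /esym/eqP; rewrite oner_eq0.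
have exJ : exists i : J, true.
  case: (pickP (@predT J)) => [i _|e]; first by exists i.
  by move: v1; rewrite big_pred0 // => /esym/eqP; rewrite oner_eq0.
have Bv i : 0 < \sum_j B i j * v j by apply: sum_gt0 => // j; rewrite mulr_gt0.
have Bu i : 0 < \sum_j B j i * u j by apply: sum_gt0 => // j; rewrite mulr_gt0.
have Bw i j : 0 <= B i j by exact: ltW.
have b1 : b <= 1.
  by case: exI exJ => i _ [j _]; have /andP[] := Bb i j; exact: le_trans.
set y := sk_col B u v; set x := sk_row B u v.
have y0 k j : 0 < y k j by exact: sk_col_gt0.
have x0 k j : 0 < x k j by exact: sk_row_gt0.
pose f k j := y k.+1 j * (y k j)^-1.
have f0 k j : 0 < f k j by exact: divr_gt0.
have [c c0 hc] := osc_le_exists (f0 0%N).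
have xE k i : x k i * kapp (wker B v) (y k) i = 1 by exact: sk_row_marginal.
(* One round maps [f k] to [f k.+1] through the Markov kernels given by the
   scaled matrices [x_k B y_k] and [x_k B y_(k+1)]. *)
pose P k i j := x k i * wker B v i j * y k j.
pose Q k j i := y k.+1 j * wker (transp B) u j i * x k i.
have fS k : f k.+1 =1 sk_round (P k) (Q k) (f k).
  move=> j.
  have yS : y k.+1 =1 (fun l => y k l * f k l).
    by move=> l; rewrite /f mulrCA divff ?mulr1 // gt_eqF.
  have -> : f k.+1 j =
      (y k.+1 j)^-1 * sk_round (wker B v) (wker (transp B) u) (y k.+1) j.
    by rewrite mulrC.
  rewrite /sk_round (half_step_ext _ (half_step_ext _ yS)).
  rewrite -/(sk_round _ _ _) (@sk_round_rescale _ _ _ _ _ (x k) _ (y k.+1)).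
  - by rewrite mulKf ?gt_eqF.
  - by move=> i; rewrite gt_eqF.
  - by rewrite gt_eqF.
have hP k i : \sum_j P k i j = 1.
  rewrite -(xE k i) /kapp mulr_sumr; apply: eq_bigr => j _.
  by rewrite /P; ring.
have hQ k j : \sum_i Q k j i = 1.
  have -> : 1 = y k.+1 j * kapp (wker (transp B) u) (x k) j.
    rewrite /y /= /sk_round /half_step mulVf // gt_eqF //.
    exact: kapp_col_gt0 (x0 k).
  by rewrite /kapp mulr_sumr; apply: eq_bigr => i _; rewrite /Q; ring.
have P0 k i j : 0 <= P k i j by rewrite /P /wker !mulr_ge0 // ltW.
have Q0 k i j : 0 <= Q k i j by rewrite /Q /wker /transp !mulr_ge0 // ltW.
(* As [B <= 1], every [x k l * Y] is at least 1, so all rows of [P k] dominate [b] times the same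
   probability vector [v j * y k j / Y]. *)
have ov k i i' : b <= overlap (P k) i i'.
  pose Y := \sum_j v j * y k j.
  have Y0 : 0 < Y by apply: sum_gt0 => // j; rewrite mulr_gt0.
  have xY l : 1 <= x k l * Y.
    rewrite -(xE k l) ler_wpM2l ?(ltW (x0 _ _)) //; apply: ler_sum => j _.
    rewrite ler_wpM2r ?(ltW (y0 _ _)) // /wker ler_piMl ?(ltW (v0 _)) //.
    by have /andP[] := Bb l j.
  have -> : b = \sum_j b * (v j * y k j) / Y.
    by rewrite -mulr_suml -mulr_sumr mulfK ?gt_eqF.
  apply: ler_sum => j _.
  have vy0 : 0 < v j * y k j by rewrite mulr_gt0.
  have key l : b * (v j * y k j) / Y <= P k l j.
    rewrite ler_pdivrMr // /P /wker.
    have -> : x k l * (B l j * v j) * y k j * Y =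
       (x k l * Y * B l j) * (v j * y k j) by ring.
    rewrite ler_wpM2r ?(ltW vy0) //.
    have /andP[bB _] := Bb l j; have := xY l; nra.
  by rewrite le_min !key.
have osck k : osc_le (1 + (1 - b) ^+ k * c) (f k).
  elim: k => [|k IH]; first by rewrite expr0 mul1r.
  have e1 : 1 <= 1 + (1 - b) ^+ k * c.
    by rewrite lerDl mulr_ge0 // exprn_ge0 // subr_ge0.
  apply: osc_le_ext (fun j => esym (fS k j)) _.
  have := @sk_round_osc _ _ _ (P k) (Q k) (f k) 1 1 b _ (P0 k) (Q0 k) ltr01
    _ _ _ _ e1 (f0 k) IH.
  have -> : (1 / 1) ^+ 2 * (1 + (1 - b) * (1 + (1 - b) ^+ k * c - 1)) =
     1 + (1 - b) ^+ k.+1 * c :> R by rewrite divr1 expr1n exprS; ring.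
  apply=> [i|j||]; rewrite ?hP ?hQ ?lexx ?b1 ?(ltW b0) //.
  by left=> i i'; rewrite mul1r.
have [N hN] : exists N, (1 - b) ^+ N * c <= h.
  (* [c] is only known to be nonnegative, whereas [geometric_decay] needs a positive constant; hence
     [c + 1]. *)
  pose N := (Num.truncn (ln ((c + 1) / h) / b)).+1; exists N.
  apply: le_trans (_ : (1 - b) ^+ N * (c + 1) <= _).
    by rewrite ler_wpM2l ?exprn_ge0 ?subr_ge0 // lerDl.
  apply: geometric_decay => //; first by rewrite ltr_wpDl.
  rewrite (mulrC b) -ler_pdivrMr //; exact: ltW (truncnS_gt _).
exists (x N), (y N); split => // [i|j].
  by rewrite xE subrr normr0 ltW.
apply: le_trans (_ : 1 + (1 - b) ^+ N * c - 1 <= _); last by lra.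
apply: sk_col_marginal_near1 => //.
  by rewrite lerDl mulr_ge0 // exprn_ge0 // subr_ge0.
apply: osc_le_ext (osc_le_inv (f0 N) (osck N)) => l.
exact: invf_div.
Qed.

End Weighted.

(** * Scalings of dense matrices *)

Section Dense.
Variables (R : realType).
Implicit Types (I J : finType).

Lemma exists_ge_mean J (v z : J -> R) :
  (forall j, 0 <= v j) -> \sum_j v j = 1 -> exists j, \sum_l v l * z l <= z j.
Proof.
move=> v0 v1; have [j0 _|e] := pickP (@predT J); last first.
  by move: v1; rewrite big_pred0 // => /esym/eqP; rewrite oner_eq0.
have [j _ hj] := arg_maxP z (erefl : xpredT j0); exists j.
rewrite -[X in _ <= X]mul1r -v1 mulr_suml.
by apply: ler_sum => l _; rewrite ler_wpM2l //; exact: hj.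
Qed.

(** Only the block where [P] and [Q] both hold is counted twice on the left. *)
Lemma sum_incl_excl I J (F : I -> J -> R) (P : pred I) (Q : pred J) :
  (forall i j, 0 <= F i j) ->
  \sum_(i | P i) \sum_j F i j + \sum_(j | Q j) \sum_i F i j <=
  \sum_i \sum_j F i j + \sum_(i | P i) \sum_(j | Q j) F i j.
Proof.
move=> F0; rewrite [\sum_(j | Q j) _]exchange_big /=.
rewrite (bigID P predT) /= (bigID P predT (fun i => \sum_j F i j)) /=.
have : \sum_(i | ~~ P i) \sum_(j | Q j) F i j <= \sum_(i | ~~ P i) \sum_j F i j.
  apply: ler_sum => i _; rewrite (bigID Q predT) /= lerDl.
  exact: sumr_ge0.
lra.
Qed.

Lemma approx_scaling_sym I J (B : I -> J -> R) u v h x y :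
  approx_scaling B u v h x y -> approx_scaling (transp B) v u h y x.
Proof. by case=> x0 y0 hx hy; split. Qed.

Lemma dense_le_kapp I J (B : I -> J -> R) (v y : J -> R) (r : R) i :
  (forall j, 0 <= B i j) -> (forall j, 0 < v j) -> (forall j, 0 < y j) ->
  r * (\sum_(j | r < B i j) v j * y j) <= kapp (wker B v) y i.
Proof.
move=> B0 /(fun h j => ltW (h j)) v0 /(fun h j => ltW (h j)) y0.
rewrite mulr_sumr [leRHS](bigID (fun j => r < B i j)) /=.
rewrite ler_wpDr //.
  by apply: sumr_ge0 => j _; rewrite /wker !mulr_ge0.
apply: ler_sum => j /ltW rB.
by rewrite /wker -mulrA ler_wpM2r ?mulr_ge0 //.
Qed.

Lemma dense_le_sum J (b v : J -> R) (r g : R) :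
  (forall j, 0 <= b j) -> (forall j, 0 < v j) -> 0 <= r ->
  g <= \sum_(j | r < b j) v j -> r * g <= \sum_j b j * v j.
Proof.
move=> b0 v0 r0 hg; apply: le_trans (ler_wpM2l r0 hg) _.
rewrite mulr_sumr big_mkcond; apply: ler_sum => j _.
case: ifP => [/ltW rb|_]; last by rewrite mulr_ge0 // ltW.
by rewrite ler_wpM2r // ltW.
Qed.

(** * A priori bounds for approximate scalings *)

Section Bounds.
Context (I J : finType) (B : I -> J -> R) (u : I -> R) (v : J -> R).
Context (r gr gc h : R) (x : I -> R) (y : J -> R).
Hypothesis B01 : forall i j, 0 <= B i j <= 1.
Hypothesis u0 : forall i, 0 < u i.
Hypothesis v0 : forall j, 0 < v j.
Hypothesis u1 : \sum_i u i = 1.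
Hypothesis v1 : \sum_j v j = 1.
Hypothesis r0 : 0 < r.
Hypothesis gr1 : gr <= 1.
Hypothesis gc1 : gc <= 1.
Hypothesis Br : forall i, gr <= \sum_(j | r < B i j) v j.
Hypothesis Bc : forall j, gc <= \sum_(i | r < B i j) u i.
Let d : R := gr + gc - 1.
Hypothesis d0 : 0 < d.
Hypothesis hd : h <= d / 8.
Hypothesis Bxy : approx_scaling B u v h x y.
Let X : R := \sum_i u i * x i.
Let Y : R := \sum_j v j * y j.

Let B0 i j : 0 <= B i j. Proof. by have /andP[] := B01 i j. Qed.
Let B1 i j : B i j <= 1. Proof. by have /andP[] := B01 i j. Qed.
Let x0 i : 0 < x i. Proof. by have [] := Bxy. Qed.
Let y0 j : 0 < y j. Proof. by have [] := Bxy. Qed.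
Let u0' i := ltW (u0 i).
Let v0' j := ltW (v0 j).
Let x0' i := ltW (x0 i).
Let y0' j := ltW (y0 j).
Let r0' := ltW r0.
Let hx i : 1 - h <= x i * kapp (wker B v) y i <= 1 + h.
Proof. by have [_ _ H _] := Bxy; move: (H i); rewrite ler_distl. Qed.
Let hy j : 1 - h <= y j * kapp (wker (transp B) u) x j <= 1 + h.
Proof. by have [_ _ _ H] := Bxy; move: (H j); rewrite ler_distl. Qed.

(* The rows in which a column [j0] with [Y <= y j0] is dense and the columns in
   which a row [i0] with [X <= x i0] is dense have together mass about
   [gr + gc > 1], so their intersection has mass about [d]; but both of them
   carry little of [X] and [Y]. *)
Lemma scaling_mass : X * Y * (r ^+ 2 * d) <= 3.
Proof.
have [i0 hi0] := exists_ge_mean x (fun i => ltW (u0 i)) u1.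
have [j0 hj0] := exists_ge_mean y (fun j => ltW (v0 j)) v1.
rewrite -/X -/Y in hi0 hj0.
pose F i j := u i * x i * (wker B v i j * y j).
have F0 i j : 0 <= F i j by rewrite /F /wker !mulr_ge0 //.
have := sum_incl_excl (fun i => r < B i j0) (fun j => r < B i0 j) F0.
have FI i : \sum_j F i j = u i * (x i * kapp (wker B v) y i).
  by rewrite -mulr_sumr mulrA.
have FJ j : \sum_i F i j = v j * (y j * kapp (wker (transp B) u) x j).
  rewrite /kapp !mulr_sumr; apply: eq_bigr => i _.
  by rewrite /F /wker /transp; ring.
set s := \sum_(i | r < B i j0) u i * x i.
set t := \sum_(j | r < B i0 j) v j * y j.
have rtX : r * t * X <= 1 + h.
  have rt0 : 0 <= r * t.
    by rewrite mulr_ge0 ?sumr_ge0 // => j _; rewrite mulr_ge0 //.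
  have /andP[_ h2] := hx i0; apply: le_trans h2.
  apply: le_trans (_ : r * t * x i0 <= _); first by rewrite ler_wpM2l.
  by rewrite mulrC ler_wpM2l // dense_le_kapp.
have rsY : r * s * Y <= 1 + h.
  have rs0 : 0 <= r * s.
    by rewrite mulr_ge0 ?sumr_ge0 // => j _; rewrite mulr_ge0 //.
  have /andP[_ h2] := hy j0; apply: le_trans h2.
  apply: le_trans (_ : r * s * y j0 <= _); first by rewrite ler_wpM2l.
  rewrite mulrC ler_wpM2l //.
  by apply: (dense_le_kapp (B := transp B)) => // i; exact: B0.
have -> : \sum_i \sum_j F i j = \sum_i u i * (x i * kapp (wker B v) y i).
  by apply: eq_bigr => i _; exact: FI.
have tot : \sum_i u i * (x i * kapp (wker B v) y i) <= 1 + h.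
  rewrite -[1 + h]mul1r -{1}u1 mulr_suml; apply: ler_sum => i _.
  by rewrite ler_wpM2l //; have /andP[] := hx i.
have h1 : h <= 1 by apply: le_trans hd _; rewrite /d; move: gr1 gc1; lra.
have mI : (1 - h) * gc <= \sum_(i | r < B i j0) \sum_j F i j.
  apply: le_trans (_ : (1 - h) * \sum_(i | r < B i j0) u i <= _).
    by rewrite ler_wpM2l // subr_ge0.
  rewrite mulr_sumr; apply: ler_sum => i _.
  by rewrite FI mulrC ler_wpM2l //; have /andP[] := hx i.
have mJ : (1 - h) * gr <= \sum_(j | r < B i0 j) \sum_i F i j.
  apply: le_trans (_ : (1 - h) * \sum_(j | r < B i0 j) v j <= _).
    by rewrite ler_wpM2l // subr_ge0.
  rewrite mulr_sumr; apply: ler_sum => j _.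
  by rewrite FJ mulrC ler_wpM2l //; have /andP[] := hy j.
have mIJ : \sum_(i | r < B i j0) \sum_(j | r < B i0 j) F i j <= s * t.
  rewrite /s /t mulr_suml; apply: ler_sum => i _; rewrite mulr_sumr.
  apply: ler_sum => j _; rewrite /F ler_wpM2l ?mulr_ge0 //.
  by rewrite /wker -mulrA ler_piMl ?mulr_ge0 //.
move: mI mJ mIJ tot.
move: (\sum_(i | r < B i j0) \sum_j F i j) => a1.
move: (\sum_(j | r < B i0 j) \sum_i F i j) => a2.
move: (\sum_(i | r < B i j0) \sum_(j | r < B i0 j) F i j) => a3.
move: (\sum_i u i * (x i * kapp (wker B v) y i)) => a4 mI mJ mIJ tot ie.
have X0 : 0 <= X by apply: sumr_ge0 => i _; rewrite mulr_ge0 //.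
have Y0 : 0 <= Y by apply: sumr_ge0 => i _; rewrite mulr_ge0 //.
have s0 : 0 <= s by apply: sumr_ge0 => i _; rewrite mulr_ge0 //.
have t0 : 0 <= t by apply: sumr_ge0 => i _; rewrite mulr_ge0 //.
have d1 : d <= 1 by rewrite /d; move: gr1 gc1; lra.
have h0 : 0 <= h.
  by have [_ _ H _] := Bxy; exact: le_trans (normr_ge0 _) (H i0).
have grc : gr + gc = 1 + d by rewrite /d; ring.
(* Inclusion-exclusion gives [(1 - h) * (1 + d) <= 1 + h + s * t], and the terms in [h] cost at most
   [3 / 8 * d]. Multiplying [rtX] by [rsY] then bounds [X * Y * (r ^+ 2 * d)] by 81/40. *)
have st : 5 / 8 * d <= s * t by move: hd d0; nra.
have : (r * t * X) * (r * s * Y) <= (9 / 8) * (9 / 8).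
  by apply: ler_pM; rewrite ?mulr_ge0 //; move: hd; lra.
have : r ^+ 2 * (X * Y) * (5 / 8 * d) <= r ^+ 2 * (X * Y) * (s * t).
  by rewrite ler_wpM2l // !mulr_ge0 // exprn_ge0.
rewrite expr2; lra.
Qed.

Lemma scaling_row_ge i : 1 - h <= x i * Y.
Proof.
have /andP[h1 _] := hx i; apply: le_trans h1 _.
rewrite ler_wpM2l //; apply: ler_sum => j _.
by rewrite /wker -mulrA ler_piMl ?mulr_ge0 //.
Qed.

Lemma scaling_col_ge j : 1 - h <= y j * X.
Proof.
have /andP[h1 _] := hy j; apply: le_trans h1 _.
rewrite ler_wpM2l //; apply: ler_sum => i _.
by rewrite /wker -mulrA ler_piMl ?mulr_ge0 //; exact: B1.
Qed.

Let h18 : h <= 1 / 8.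
Proof. by apply: le_trans hd _; rewrite /d; move: gr1 gc1; lra. Qed.

Let X0 : 0 <= X. Proof. by apply: sumr_ge0 => i _; rewrite mulr_ge0. Qed.
Let Y0 : 0 <= Y. Proof. by apply: sumr_ge0 => j _; rewrite mulr_ge0. Qed.

(** Both [x i * Y] and [y j * X] are at least 7/8, and [scaling_mass] bounds [X * Y] from above. *)
Lemma scaling_prod_ge i j : r ^+ 2 * d / 4 <= x i * y j.
Proof.
have q0 : 0 <= r ^+ 2 * d by rewrite mulr_ge0 ?exprn_ge0 ?(ltW d0).
have hp : 49 / 64 <= (x i * y j) * (X * Y).
  have -> : (x i * y j) * (X * Y) = (x i * Y) * (y j * X) by ring.
  apply: le_trans (_ : 7 / 8 * (7 / 8) <= _); first by lra.
  apply: ler_pM; try lra.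
    by apply: le_trans (scaling_row_ge i); move: h18; lra.
  by apply: le_trans (scaling_col_ge j); move: h18; lra.
have := ler_wpM2l q0 hp.
have := ler_wpM2l (mulr_ge0 (x0' i) (y0' j)) scaling_mass; lra.
Qed.

(** Every [y j] is at least [7 / (8 X)], so a row marginal of at most 9/8, restricted to the dense
    columns, forces [x i = O(X / (r d))]; [scaling_mass] then bounds [x i * Y]. *)
Lemma scaling_row_le i : x i * Y * (r ^+ 3 * d ^+ 2) <= 4.
Proof.
have hS : 7 / 8 * gr <= (\sum_(j | r < B i j) v j * y j) * X.
  apply: le_trans (_ : 7 / 8 * (\sum_(j | r < B i j) v j) <= _).
    by rewrite ler_wpM2l //; lra.
  rewrite mulr_sumr mulr_suml; apply: ler_sum => j _.
  rewrite mulrC -mulrA ler_wpM2l //.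
  by apply: le_trans (scaling_col_ge j); move: h18; lra.
have hT : x i * (r * \sum_(j | r < B i j) v j * y j) <= 9 / 8.
  have /andP[_ h2] := hx i; apply: le_trans (_ : 1 + h <= _).
    by apply: le_trans h2; rewrite ler_wpM2l // dense_le_kapp.
  by move: h18; lra.
move: (\sum_(j | r < B i j) v j * y j) hS hT => S hS hT.
have dg : d <= gr by rewrite /d; move: gc1; lra.
have h1 : x i * r * (7 / 8 * d) <= 9 / 8 * X.
  apply: le_trans (_ : x i * r * (S * X) <= _).
    rewrite ler_wpM2l ?mulr_ge0 //; apply: le_trans hS.
    by rewrite ler_wpM2l //; lra.
  have := ler_wpM2r X0 hT; lra.
have q0 : 0 <= Y * (r ^+ 2 * d) by rewrite !mulr_ge0 ?exprn_ge0 ?(ltW d0).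
have := ler_wpM2r q0 h1; have := scaling_mass.
have -> : x i * Y * (r ^+ 3 * d ^+ 2) = x i * r * d * (Y * (r ^+ 2 * d)).
  by ring.
lra.
Qed.

End Bounds.

Lemma approx_scaling_dense I J (B : I -> J -> R) (u : I -> R) (v : J -> R)
    (r gr gc h : R) :
  (forall i j, 0 <= B i j <= 1) ->
  (forall i, 0 < u i) -> (forall j, 0 < v j) ->
  \sum_i u i = 1 -> \sum_j v j = 1 ->
  0 < r <= 1 -> gr <= 1 -> gc <= 1 ->
  (forall i, gr <= \sum_(j | r < B i j) v j) ->
  (forall j, gc <= \sum_(i | r < B i j) u i) ->
  0 < gr + gc - 1 -> 0 < h ->
  exists x, exists y, approx_scaling B u v h x y.
Proof.
move=> B01 u0 v0 u1 v1 /andP[r0 r1] gr1 gc1 Br Bc d0 h0.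
set d := gr + gc - 1 in d0 *.
set q := r ^+ 3 * d ^+ 2.
have q0 : 0 < q by rewrite mulr_gt0 ?exprn_gt0.
(* Flooring the entries at [b <= r] preserves the density, and by
   [scaling_row_le] moves the marginals by at most [4 b / q <= h / 2]. *)
pose b := Num.min r (h * q / 8).
have b0 : 0 < b by rewrite lt_min r0 divr_gt0 // mulr_gt0.
have br : b <= r by rewrite ge_min lexx.
have bq : b <= h * q / 8 by rewrite ge_min lexx orbT.
pose B' i j := Num.max (B i j) b.
have rB' i j : (r < B' i j) = (r < B i j).
  by rewrite lt_max orb_idr // => rb; move: (le_lt_trans br rb); rewrite ltxx.
have bB' i j : b <= B' i j <= 1.
  rewrite le_max lexx orbT ge_max (le_trans br r1) andbT.
  by have /andP[] := B01 i j.
have B'01 i j : 0 <= B' i j <= 1.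
  by have /andP[h1 h2] := bB' i j; rewrite h2 (le_trans (ltW b0) h1).
have BB' i j : B i j <= B' i j <= B i j + b.
  have /andP[Bij _] := B01 i j.
  by rewrite le_max lexx /= ge_max lerDl (ltW b0) lerDr.
(* Half of [h] is for the scaling of the floored matrix, the other half for removing the floor;
   [d / 8] is the precision that [scaling_row_le] requires. *)
pose h' := Num.min (h / 2) (d / 8).
have h'0 : 0 < h' by rewrite lt_min !divr_gt0.
have h'h : h' <= h / 2 by rewrite ge_min lexx.
have h'd : h' <= d / 8 by rewrite ge_min lexx orbT.
have [x [y xy]] := approx_scaling_pos b0 bB' u0 v0 u1 v1 h'0.
have [x0 y0 hx hy] := xy; exists x, y.
have Br' i : gr <= \sum_(j | r < B' i j) v j by under eq_bigl do rewrite rB'.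
have Bc' j : gc <= \sum_(i | r < B' i j) u i by under eq_bigl do rewrite rB'.
have step (K L : finType) (A A' : K -> L -> R) (w : L -> R) (z : K -> R)
      (z' : L -> R) k :
    (forall k l, A k l <= A' k l <= A k l + b) -> (forall l, 0 < w l) ->
    (forall l, 0 < z' l) -> 0 < z k -> z k * (\sum_l w l * z' l) * q <= 4 ->
    `|z k * kapp (wker A' w) z' k - 1| <= h' ->
    `|z k * kapp (wker A w) z' k - 1| <= h.
  move=> AA w0 z'0 zk hq.
  have h1 : kapp (wker A w) z' k <= kapp (wker A' w) z' k.
    apply: ler_sum => l _; have /andP[h1 _] := AA k l.
    by rewrite /wker !ler_wpM2r // ltW.
  have h2 : kapp (wker A' w) z' k <=
      kapp (wker A w) z' k + b * \sum_l w l * z' l.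
    rewrite mulr_sumr -big_split; apply: ler_sum => l _ /=.
    have /andP[_ h2] := AA k l.
    by rewrite /wker mulrA -mulrDl -mulrDl !ler_wpM2r // ltW.
  have := ler_wpM2l (ltW zk) h1; have := ler_wpM2l (ltW zk) h2.
  have : z k * (\sum_l w l * z' l) * b <= h / 2.
    have Z0 : 0 <= z k * (\sum_l w l * z' l).
      rewrite mulr_ge0 ?(ltW zk) // sumr_ge0 // => l _.
      by rewrite mulr_ge0 // ltW.
    have := ler_wpM2l Z0 bq; have := ler_wpM2l (ltW h0) hq; lra.
  move: (kapp _ _ _) (kapp _ _ _) => a a'; rewrite !ler_distl => *; lra.
split => // [i|j].
  apply: (step _ _ B B') => //.
  exact: (scaling_row_le B'01 u0 v0 u1 v1 r0 gr1 gc1 Br' Bc' d0 h'd xy).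
apply: (step _ _ (transp B) (transp B')) => // [k l|].
  exact: BB'.
have d0' : 0 < gc + gr - 1 by rewrite (addrC gc).
have h'd' : h' <= (gc + gr - 1) / 8 by rewrite (addrC gc).
have := scaling_row_le _ v0 u0 v1 u1 r0 gc1 gr1 Bc' Br' d0' h'd'
  (approx_scaling_sym xy) j.
by rewrite (addrC gc); apply=> k l; exact: B'01.
Qed.

End Dense.

(** * Rate of convergence *)

Section Rate.
Variables (R : realType).
Implicit Types (I J : finType).

(** Two sets of mass at least [g] in a probability space meet in mass at least [2 * g - 1], and
    there both rows are at least [c * v j]. *)
Lemma overlap_dense I J (P B : I -> J -> R) (v : J -> R) (r c g : R) i i' :
  (forall i j, 0 <= P i j) -> (forall j, 0 <= v j) -> \sum_j v j = 1 ->
  0 <= c -> (forall i j, r < B i j -> c * v j <= P i j) ->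
  (forall i, g <= \sum_(j | r < B i j) v j) ->
  c * (2 * g - 1) <= overlap P i i'.
Proof.
move=> P0 v0 v1 c0 hP hB.
have cap : 2 * g - 1 <= \sum_(j | (r < B i j) && (r < B i' j)) v j.
  have : \sum_(j | r < B i j) v j + \sum_(j | r < B i' j) v j <=
      \sum_j v j + \sum_(j | (r < B i j) && (r < B i' j)) v j.
    rewrite big_mkcond [X in _ + X <= _]big_mkcond [X in _ <= _ + X]big_mkcond.
    rewrite -!big_split /=; apply: ler_sum => j _.
    by case: (r < B i j) => /=; case: (r < B i' j) => /=; have := v0 j; lra.
  by have := hB i; have := hB i'; rewrite v1; lra.
apply: le_trans (ler_wpM2l c0 cap) _.
rewrite mulr_sumr big_mkcond; apply: ler_sum => j _.
case: ifP => [/andP[h1 h2]|_]; last by rewrite le_min !P0.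
by rewrite le_min !hP.
Qed.

(** The iterates are measured relative to a fixed approximate scaling, whose precision depends on
    [e]. The excess oscillation then obeys a linear recursion: contraction by the overlap plus a
    small loss [s] from the inexact marginals. *)
Lemma sk_col_marginal_rate I J (B : I -> J -> R) (u : I -> R) (v : J -> R)
    (r gr gc e : R) (k : nat) (j : J) :
  let d := gr + gc - 1 in
  (forall i j, 0 <= B i j <= 1) ->
  (forall i, 0 < u i) -> (forall j, 0 < v j) ->
  \sum_i u i = 1 -> \sum_j v j = 1 ->
  0 < r <= 1 -> gr <= 1 -> gc <= 1 ->
  (forall i, gr <= \sum_(j | r < B i j) v j) ->
  (forall j, gc <= \sum_(i | r < B i j) u i) ->
  0 < d -> 0 < e <= 1 ->
  (1 - r ^+ 3 * d ^+ 2 / 16) ^+ k * (5 / (r ^+ 3 * d ^+ 2)) <= e / 6 ->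
  `|sk_col B u v k j * kapp (wker (transp B) u) (sk_row B u v k) j - 1| <= e.
Proof.
move=> d B01 u0 v0 u1 v1 r01 gr1 gc1 Br Bc d0 /andP[e0 e1] hk.
have /andP[r0 r1] := r01.
have d1 : d <= 1 by rewrite /d; lra.
set q := r ^+ 3 * d ^+ 2 in hk.
have q0 : 0 < q by rewrite mulr_gt0 ?exprn_gt0.
have qd : q <= d.
  rewrite /q expr2 mulrA ger_pMl // mulr_ile1 ?exprn_ge0 ?(ltW d0) ?(ltW r0) //.
  by rewrite exprn_ile1 ?(ltW r0).
(* Chosen so that the recursion [a m.+1 = (1 - q / 16) * a m + s] has fixed point [e / 8]. *)
pose s := q * e / 128.
have s0 : 0 < s by rewrite divr_gt0 ?mulr_gt0.
have sq : s <= q / 128 by rewrite /s; nra.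
(* Makes the loss per round, [((1 + h) / (1 - h)) ^+ 2], at most [1 + 8 * h = 1 + s]. *)
pose h := s / 8.
have h0 : 0 < h by rewrite divr_gt0.
have hd : h <= d / 8 by rewrite /h; lra.
have h8 : h <= 1 / 8 by lra.
have [x [y xy]] := approx_scaling_dense B01 u0 v0 u1 v1 r01 gr1 gc1 Br Bc d0 h0.
have [x0 y0 hx hy] := xy.
have B0 i l : 0 <= B i l by have /andP[] := B01 i l.
have gr0 : 0 < gr by move: d0; rewrite /d; lra.
have gc0 : 0 < gc by move: d0; rewrite /d; lra.
have Bv i : 0 < \sum_l B i l * v l.
  apply: lt_le_trans (dense_le_sum (B0 i) v0 (ltW r0) (Br i)).
  exact: mulr_gt0.
have Bu l : 0 < \sum_i B i l * u i.
  apply: lt_le_trans (dense_le_sum (B0^~ l) u0 (ltW r0) (Bc l)).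
  exact: mulr_gt0.
pose P i l := x i * wker B v i l * y l.
pose Q l i := y l * wker (transp B) u l i * x i.
pose z m l := sk_col B u v m l / y l.
have sk0 m l : 0 < sk_col B u v m l by exact: sk_col_gt0.
have z0 m l : 0 < z m l by exact: divr_gt0.
have zS m : z m.+1 =1 sk_round P Q (z m).
  move=> l; have yS : sk_col B u v m =1 (fun l => y l * z m l).
    by move=> l'; rewrite /z mulrCA divff ?mulr1 // gt_eqF.
  rewrite /z [sk_col _ _ _ m.+1]/= /sk_round.
  rewrite (half_step_ext _ (half_step_ext _ yS)).
  rewrite -/(sk_round _ _ _) (@sk_round_rescale _ _ _ _ _ x _ y).
  - by rewrite mulrAC divff ?mul1r // gt_eqF.
  - by move=> i; rewrite gt_eqF.
  - by rewrite gt_eqF.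
have P0 i l : 0 <= P i l by rewrite /P /wker !mulr_ge0 // ltW.
have Q0 l i : 0 <= Q l i by rewrite /Q /wker /transp !mulr_ge0 // ltW.
have hP i : 1 - h <= \sum_l P i l <= 1 + h.
  have -> : \sum_l P i l = x i * kapp (wker B v) y i.
    by rewrite mulr_sumr; apply: eq_bigr => l _; rewrite /P; ring.
  by rewrite -ler_distl.
have hQ l : 1 - h <= \sum_i Q l i <= 1 + h.
  have -> : \sum_i Q l i = y l * kapp (wker (transp B) u) x l.
    by rewrite mulr_sumr; apply: eq_bigr => i _; rewrite /Q; ring.
  by rewrite -ler_distl.
have prod_ge := scaling_prod_ge B01 u0 v0 u1 v1 r0 gr1 gc1 Br Bc d0 hd xy.
pose c := r * (r ^+ 2 * d / 4).
have c0 : 0 <= c by rewrite !mulr_ge0 ?exprn_ge0 ?invr_ge0 ?ltW.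
have xBy i l : r < B i l -> c <= x i * B i l * y l.
  move=> /ltW rB; rewrite mulrAC mulrC; apply: ler_pM => //; first exact: ltW.
  by rewrite !mulr_ge0 ?exprn_ge0 ?invr_ge0 ?ltW.
(* The overlap is at least [c * d = q / 4]; halving it absorbs the factor [1 + h]. *)
pose t := q / 8.
have t01 : 0 <= t <= 1 by rewrite /t; apply/andP; split; lra.
have ct g : d <= 2 * g - 1 -> (1 + h) * t <= c * (2 * g - 1).
  move=> dg; apply: le_trans (ler_wpM2l c0 dg).
  have -> : c * d = q / 4 by rewrite /c /q; field.
  by rewrite /t; nra.
have ov : (forall i i', (1 + h) * t <= overlap P i i') \/
    (forall l l', (1 + h) * t <= overlap Q l l').
  (* The larger of [gr] and [gc] is at least [(1 + d) / 2], so the corresponding [2 * g - 1] is at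
     least [d]. *)
  have [grc|/ltW grc] := lerP gc gr; [left => i i' | right => l l'].
    apply: le_trans (ct gr _) _; first by rewrite /d; lra.
    apply: (@overlap_dense _ _ P B v r) => // [l|m l /xBy hc]; first exact: ltW.
    rewrite /P /wker.
    have -> : x m * (B m l * v l) * y l = x m * B m l * y l * v l by ring.
    by rewrite ler_wpM2r // ltW.
  apply: le_trans (ct gc _) _; first by rewrite /d; lra.
  apply: (@overlap_dense _ _ Q (transp B) u r) => // [i|m i /xBy hc].
    exact: ltW.
  rewrite /Q /wker /transp.
  have -> : y m * (B i m * u i) * x i = x i * B i m * y m * u i by ring.
  by rewrite ler_wpM2r // ltW.
pose rho := (1 + h) / (1 - h).
have rho2 : rho ^+ 2 <= 1 + s.
  have h10 : 0 < 1 - h by lra.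
  rewrite /rho expr_div_n ler_pdivrMr ?exprn_gt0 // !expr2.
  have -> : s = 8 * h by rewrite /h; field.
  by nra.
pose a m : R := (1 - t / 2) ^+ m * (5 / q) + e / 8.
have tq : 1 - t / 2 = 1 - q / 16 by rewrite /t; field.
have a0 m : 0 <= a m.
  apply: addr_ge0; last by lra.
  apply: mulr_ge0; last by apply: divr_ge0; [exact: ler0n | exact: ltW].
  apply: exprn_ge0; rewrite tq; lra.
have aS m : rho ^+ 2 * (1 + (1 - t) * a m) <= 1 + a m.+1.
  have -> : a m.+1 = (1 - t / 2) * a m + s.
    by rewrite /a exprS /t /s; field; rewrite gt_eqF.
  have b0 : 0 <= 1 + (1 - t) * a m.
    have /andP[_ t1] := t01.
    by rewrite addr_ge0 // mulr_ge0 // subr_ge0.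
  apply: le_trans (ler_wpM2r b0 rho2) _.
  (* Half of the contraction pays for the cross term [s * (1 - t) * A]. *)
  have st : s <= t / 2 by rewrite /t; lra.
  have /andP[t0 t1] := t01.
  have := a0 m; move: (a m) => A A0.
  have := ler_wpM2r A0 st.
  have : 0 <= s * (t * A) by rewrite mulr_ge0 ?(ltW s0) // mulr_ge0.
  lra.
have zosc m : osc_le (1 + a m) (z m).
  elim: m => [|m IH].
    (* At the start [z 0] is [1 / y], and all [y l * X] lie between [1 - h] and [4 / q]. *)
    pose X := \sum_i u i * x i.
    have X0 : 0 < X.
      have h1 := scaling_col_ge B01 u0 xy j.
      have : 0 < y j * X by apply: lt_le_trans h1; lra.
      by rewrite pmulr_rgt0.
    apply: osc_le_mono (z0 _) (_ : 5 / q <= _) _.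
      by rewrite /a expr0; lra.
    apply: osc_le_ext (_ : (fun l => (y l)^-1) =1 _) _.
      by move=> l; rewrite /z /= mul1r.
    apply: osc_le_inv => // l l'.
    have h1 := scaling_col_ge B01 u0 xy l'.
    have d0' : 0 < gc + gr - 1 by rewrite (addrC gc).
    have hd' : h <= (gc + gr - 1) / 8 by rewrite (addrC gc).
    have := scaling_row_le (fun l i => B01 i l) v0 u0 v1 u1 r0 gc1 gr1 Bc Br d0'
      hd' (approx_scaling_sym xy) l.
    rewrite (addrC gc) -/d -/q => h2.
    rewrite mulrAC ler_pdivlMr // -(ler_pM2r X0).
    rewrite -/X in h1 h2; lra.
  have am1 : 1 <= 1 + a m by rewrite lerDl.
  have h10 : 0 < 1 - h by lra.
  have := sk_round_osc P0 Q0 h10 hP hQ ov t01 am1 (z0 m) IH.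
  rewrite (_ : 1 + a m - 1 = a m); last by ring.
  move=> H; apply: osc_le_ext (fun l => esym (zS m l)) _.
  by apply: osc_le_mono (aS m) H => l; rewrite -zS.
have ak : a k <= 7 / 24 * e by rewrite /a tq; lra.
have akS : a k.+1 <= a k.
  rewrite lerD2r exprS -mulrA.
  rewrite ger_pMl ?mulr_gt0 ?exprn_gt0 ?invr_gt0 //; last by rewrite tq; lra.
  by rewrite tq; lra.
(* The column marginal equals [z k / z k.+1], whose oscillation is at most the product of those of
   [z k] and [z k.+1]. *)
apply: le_trans (_ : (1 + a k) * (1 + a k) - 1 <= _); last first.
  have := a0 k; nra.
apply: sk_col_marginal_near1 => //; first by have := a0 k; nra.
have skz l : z k l * (z k.+1 l)^-1 = sk_col B u v k l / sk_col B u v k.+1 l.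
  by rewrite /z invf_div mulrA divfK ?gt_eqF.
apply: osc_le_ext skz _; apply: osc_le_mul => //.
  by move=> l; rewrite invr_gt0.
apply: osc_le_inv => //; apply: osc_le_mono (zosc k.+1) => //.
by rewrite lerD2l.
Qed.

End Rate.

(** * The matrix iterates *)

Section Matrices.
Variables (R : realType).

(** Row normalisation forgets the previous row multipliers, in particular the constant [c]. A round
    is a column step followed by a row step, hence two iterations. *)
Lemma SK_double (m n : nat) (A : 'M[R]_(m, n)) (u : 'rV[R]_m) (v : 'rV[R]_n)
    (B : 'I_m -> 'I_n -> R) (c : R) (k : nat) i j :
  (forall i j, 0 <= B i j) ->
  (forall i, 0 < u ord0 i) -> (forall j, 0 < v ord0 j) ->
  (forall i, 0 < \sum_j B i j * v ord0 j) ->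
  (forall j, 0 < \sum_i B i j * u ord0 i) -> c != 0 ->
  (forall i j, A i j = c * (u ord0 i * B i j * v ord0 j)) ->
  SK A u v k.*2 i j =
    u ord0 i * sk_row B (u ord0) (v ord0) k i * B i j *
    (v ord0 j * sk_col B (u ord0) (v ord0) k j).
Proof.
move=> B0 u0 v0 Bv Bu c0 hA.
set x := sk_row _ _ _; set y := sk_col _ _ _.
have x0 l i' : 0 < x l i' by exact: sk_row_gt0.
have y0 l j' : 0 < y l j' by exact: sk_col_gt0.
have row_step (M : 'M[R]_(m, n)) (w : 'I_m -> R) (z : 'I_n -> R) i' j' :
    (forall i, w i != 0) -> (forall i, kapp (wker B (v ord0)) z i != 0) ->
    (forall i j, M i j = u ord0 i * w i * B i j * (v ord0 j * z j)) ->
    row_scale u M i' j' =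
    u ord0 i' * half_step (wker B (v ord0)) z i' * B i' j' * (v ord0 j' * z j').
  move=> w0 k0 hM; rewrite !mxE.
  have -> : \sum_l M i' l = u ord0 i' * w i' * kapp (wker B (v ord0)) z i'.
    rewrite mulr_sumr; apply: eq_bigr => l _; rewrite hM /wker; ring.
  rewrite hM /half_step; field.
  by rewrite w0 k0 gt_eqF.
have col_step (M : 'M[R]_(m, n)) (w : 'I_m -> R) (z : 'I_n -> R) i' j' :
    (forall j, z j != 0) ->
    (forall j, kapp (wker (transp B) (u ord0)) w j != 0) ->
    (forall i j, M i j = u ord0 i * w i * B i j * (v ord0 j * z j)) ->
    col_scale v M i' j' = u ord0 i' * w i' * B i' j' *
      (v ord0 j' * half_step (wker (transp B) (u ord0)) w j').
  move=> z0 k0 hM; rewrite !mxE.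
  have -> : \sum_l M l j' =
      v ord0 j' * z j' * kapp (wker (transp B) (u ord0)) w j'.
    by rewrite mulr_sumr; apply: eq_bigr => l _; rewrite hM /wker /transp; ring.
  rewrite hM /half_step; field.
  by rewrite z0 k0 gt_eqF.
have kr l i' : kapp (wker B (v ord0)) (y l) i' != 0.
  by rewrite gt_eqF // kapp_row_gt0.
elim: k i j => [|k IH] i j.
  apply: (row_step _ (fun=> c)) => // i' j'.
  by rewrite hA /y /=; ring.
rewrite doubleS /= odd_double /=.
apply: (row_step _ (x k) (y k.+1) _ _ _ (kr k.+1)) => [i'|i' j'].
  by rewrite gt_eqF.
apply: (col_step _ (x k) (y k)) => // j''; first by rewrite gt_eqF.
by rewrite gt_eqF // kapp_col_gt0.
Qed.

(** Even iterates have exact row sums, so only the column error remains. *)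
Lemma SK_double_error (m n : nat) (A : 'M[R]_(m, n)) (u : 'rV[R]_m)
    (v : 'rV[R]_n) (B : 'I_m -> 'I_n -> R) (c : R) (k : nat) :
  (forall i j, 0 <= B i j) ->
  (forall i, 0 < u ord0 i) -> (forall j, 0 < v ord0 j) ->
  (forall i, 0 < \sum_j B i j * v ord0 j) ->
  (forall j, 0 < \sum_i B i j * u ord0 i) -> c != 0 ->
  (forall i j, A i j = c * (u ord0 i * B i j * v ord0 j)) ->
  norm1 (row_sums (SK A u v k.*2) - u) + norm1 (col_sums (SK A u v k.*2) - v) =
  \sum_j v ord0 j * `|sk_col B (u ord0) (v ord0) k j *
    kapp (wker (transp B) (u ord0)) (sk_row B (u ord0) (v ord0) k) j - 1|.
Proof.
move=> B0 u0 v0 Bv Bu c0 hA.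
have E := SK_double k _ _ B0 u0 v0 Bv Bu c0 hA.
rewrite /norm1 big1 ?add0r => [|i _].
  apply: eq_bigr => j _; rewrite !mxE.
  rewrite -[v ord0 j in RHS]gtr0_norm // -normrM; congr `|_|.
  rewrite mulrBr mulr1 mulrA mulr_sumr; congr (_ - _).
  by apply: eq_bigr => i _; rewrite E /wker /transp; ring.
rewrite !mxE; apply/eqP; rewrite normr_eq0 subr_eq0; apply/eqP.
rewrite -[RHS]mulr1 -(sk_row_marginal B0 u0 v0 Bv Bu k i) mulrA mulr_sumr.
by apply: eq_bigr => j _; rewrite E /wker; ring.
Qed.

Lemma max_entry_ge (m n : nat) (B : 'M[R]_(m, n)) i j : B i j <= max_entry B.
Proof.
apply: le_trans (le_bigmax 0 (fun j => B i j) j) _.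
exact: (le_bigmax 0 (fun i => \big[Num.max/0]_(j < n) B i j) i).
Qed.

Lemma max_entry_gt0 (m n : nat) (B : 'M[R]_(m, n)) :
  (forall i j, 0 <= B i j) -> B != 0 -> 0 < max_entry B.
Proof.
move=> B0 /matrix0Pn[i [j Bij]].
apply: lt_le_trans (max_entry_ge B i j).
by rewrite lt_neqAle eq_sym Bij B0.
Qed.

End Matrices.

(** * The initial error and the iteration count *)

(** The initial column marginals [g j] are at most [b], hence
    [|g j - 1| <= 2 * (b - 1) - (g j - 1)], and the last term has [v]-mean 0. *)
Lemma sk_start_error (R : realType) (I J : finType) (B : I -> J -> R)
    (u : I -> R) (v : J -> R) (b : R) :
  (forall i j, 0 <= B i j <= 1) ->
  (forall i, 0 < u i) -> (forall j, 0 < v j) ->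
  \sum_i u i = 1 -> \sum_j v j = 1 -> 1 <= b ->
  (forall i, 1 <= b * \sum_j B i j * v j) ->
  \sum_j v j * `|sk_col B u v 0 j * kapp (wker (transp B) u) (sk_row B u v 0) j
                 - 1| <= 2 * (b - 1).
Proof.
move=> B01 u0 v0 u1 v1 b1 hb.
have b0 : 0 < b by apply: lt_le_trans b1.
have kE i : kapp (wker B v) (fun=> 1) i = \sum_j B i j * v j.
  by apply: eq_bigr => j _; rewrite mulr1.
have k0 i : 0 < \sum_j B i j * v j.
  by rewrite -(pmulr_rgt0 _ b0); apply: lt_le_trans (hb i).
have xb i : 0 <= sk_row B u v 0 i <= b.
  rewrite /sk_row /half_step /= kE invr_ge0 ltW //=.
  by rewrite -[leLHS]mul1r ler_pdivrMr.
pose g j := sk_col B u v 0 j * kapp (wker (transp B) u) (sk_row B u v 0) j.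
have gb j : g j <= b.
  rewrite /g mul1r -[b]mul1r -u1 mulr_suml; apply: ler_sum => i _.
  have /andP[Bij0 Bij1] := B01 i j; have /andP[xi0 xib] := xb i.
  rewrite /wker /transp (mulrC (B i j)) -mulrA ler_wpM2l ?(ltW (u0 i)) //.
  by apply: le_trans xib; rewrite ler_piMl.
have gs : \sum_j v j * g j = 1.
  by rewrite sk_mass // => i; rewrite /= kE gt_eqF.
apply: le_trans (_ : \sum_j v j * (2 * (b - 1) - (g j - 1)) <= _).
  apply: ler_sum => j _; rewrite ler_wpM2l ?(ltW (v0 j)) // -/(g j).
  by rewrite ler_norml; have := gb j => gj; apply/andP; split; lra.
have -> : \sum_j v j * (2 * (b - 1) - (g j - 1)) =
    (\sum_j v j) * (2 * (b - 1)) + \sum_j v j - \sum_j v j * g j.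
  by rewrite mulr_suml -big_split -sumrB; apply: eq_bigr => j _ /=; ring.
by rewrite v1 gs mul1r addrK.
Qed.

Theorem theorem1p9 (R : realType) :
  exists C : R, 0 < C /\
    forall (gamma gamma' rho eps : R) (m n : nat)
      (u : 'rV[R]_m) (v : 'rV[R]_n) (B : 'M[R]_(m, n)),
      0 < gamma <= 1 -> 0 < gamma' <= 1 -> 0 < rho <= 1 -> 0 < eps <= 1 ->
      (0 < m)%N -> (0 < n)%N ->
      (forall i, 0 < u ord0 i) -> (forall j, 0 < v ord0 j) ->
      norm1 u = 1 -> norm1 v = 1 ->
      (forall i j, 0 <= B i j) ->
      weighted_dense gamma gamma' rho u v B ->
      1 < gamma + gamma' ->
      exists k : nat,
        k%:R <= C * (rho ^- 14 * (gamma + gamma' - 1) ^- 6 *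
                     (- ln eps - ln rho - ln (gamma + gamma' - 1))) /\
        let A := SK (diag_mx u *m B *m diag_mx v) u v k in
        norm1 (row_sums A - u) + norm1 (col_sums A - v) <= eps.
Proof.
(* The estimates at the end need [2 * 16 * 119 + 8 = 3816]. *)
exists 4000; split; first exact: ltr0n.
move=> g g' r e m n u v B /andP[g0 g1] /andP[g'0 g'1] r01 e01 m0 n0 u0 v0 u1 v1.
move=> B0 [Bn _ [_ hg] [_ hg']]; rewrite -subr_gt0; set d := g + g' - 1 => d0.
have /andP[r0 r1] := r01; have /andP[e0 e1] := e01.
have d1 : d <= 1 by rewrite /d; lra.
have dg : d <= g by rewrite /d; lra.
have us : \sum_i u ord0 i = 1.
  by rewrite -u1; apply: eq_bigr => i _; rewrite gtr0_norm.
have vs : \sum_j v ord0 j = 1.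
  by rewrite -v1; apply: eq_bigr => i _; rewrite gtr0_norm.
have M0 := max_entry_gt0 B0 Bn; set M := max_entry B in M0 hg hg'.
pose D i j := B i j / M.
have D01 i j : 0 <= D i j <= 1.
  by rewrite divr_ge0 ?(ltW M0) //= ler_pdivrMr // mul1r max_entry_ge.
have rD i j : (r < D i j) = (r * M < B i j) by rewrite ltr_pdivlMr.
have Dr i : g <= \sum_(j | r < D i j) v ord0 j.
  have := hg i; rewrite v1 divr1.
  by under eq_bigl do rewrite -rD.
have Dc j : g' <= \sum_(i | r < D i j) u ord0 i.
  have := hg' j; rewrite u1 divr1.
  by under eq_bigl do rewrite -rD.
have D0 i j : 0 <= D i j by have /andP[] := D01 i j.
have Dv i : r * g <= \sum_j D i j * v ord0 j.
  exact: dense_le_sum (D0 i) v0 (ltW r0) (Dr i).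
have Du j : r * g' <= \sum_i D i j * u ord0 i.
  exact: dense_le_sum (D0^~ j) u0 (ltW r0) (Dc j).
have rg0 : 0 < r * g by rewrite mulr_gt0.
have rg'0 : 0 < r * g' by rewrite mulr_gt0.
have hA i j : (diag_mx u *m B *m diag_mx v) i j =
    M * (u ord0 i * D i j * v ord0 j).
  rewrite mul_mx_diag mul_diag_mx !mxE /D; field.
  by rewrite gt_eqF.
have err k := SK_double_error k D0 u0 v0 (fun i => lt_le_trans rg0 (Dv i))
  (fun j => lt_le_trans rg'0 (Du j)) (lt0r_neq0 M0) hA.
set L := - ln e - ln r - ln d.
have L_ge : 1 - e * r * d <= L.
  have erd0 : 0 < e * r * d by rewrite !mulr_gt0.
  have -> : L = - ln (e * r * d).
    by rewrite !lnM ?posrE ?mulr_gt0 // /L; ring.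
  have := @le_ln1Dx R (e * r * d - 1).
  by rewrite addrCA subrr addr0 => H; have := H ltac:(lra); lra.
pose q := r ^+ 3 * d ^+ 2.
have q0 : 0 < q by rewrite mulr_gt0 ?exprn_gt0.
have qK : q^-1 <= r ^- 14 * d ^- 6.
  rewrite -invfM lef_pV2 ?posrE ?mulr_gt0 ?exprn_gt0 //.
  by rewrite ler_pM ?exprn_ge0 ?(ltW r0) ?(ltW d0) // ler_wiXn2l // ltW.
have er1 : e * r <= 1 by rewrite mulr_ile1 ?(ltW e0) ?(ltW r0).
have L0 : 0 <= L.
  apply: le_trans L_ge.
  by rewrite subr_ge0 mulr_ile1 ?mulr_ge0 ?(ltW e0) ?(ltW r0) ?(ltW d0).
have [erd|erd] := lerP (3 / 4) (e * r * d).
  (* For parameters near 1 the bound may be below 1, so the very first matrix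
     has to do. *)
  exists 0%N; split.
    have /ltW qi0 : 0 < q^-1 by rewrite invr_gt0.
    by apply: mulr_ge0 => //; apply: mulr_ge0 => //; exact: le_trans qK.
  move=> A; rewrite /A (err 0%N).
  (* Here [r * g >= 3 / 4], and the resulting error [2 / 3] is below [3 / 4 <= e]. *)
  apply: le_trans (sk_start_error (b := 4 / 3) _ _ _ _ _ _ _) _ => //.
  - by lra.
  - move=> i; have : 3 / 4 <= \sum_j D i j * v ord0 j; last by lra.
    apply: le_trans (Dv i); apply: le_trans erd _.
    rewrite ler_pM ?mulr_ge0 ?(ltW e0) ?(ltW r0) ?(ltW d0) //.
    by rewrite ler_piMl // ltW.
  - have rd1 : r * d <= 1 by rewrite mulr_ile1 ?(ltW r0) ?(ltW d0).
    have : e * r * d <= e by rewrite -mulrA ler_piMr // ltW.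
    by lra.
(* The logarithm required by [geometric_decay] to bring [5 / q] below [e / 6] at rate [q / 16]. *)
pose l := ln (5 / q / (e / 6)).
pose k := (Num.truncn (16 / q * l)).+1.
have q1 : q <= 1.
  by rewrite mulr_ile1 ?exprn_ge0 ?exprn_ile1 ?(ltW r0) ?(ltW d0).
have l0 : 0 <= l.
  apply: ln_ge0; rewrite ler_pdivlMr ?divr_gt0 // mul1r ler_pdivlMr //; nra.
have lL : l <= 29 + 3 * L.
  have -> : l = ln (1 + 29) - ln e - 3 * ln r - 2 * ln d.
    have -> : l = ln ((1 + 29) / (q * e)).
      congr ln; field; by rewrite !gt_eqF.
    have er30 : 0 < 1 + 29 :> R by lra.
    rewrite ln_div ?posrE ?mulr_gt0 // lnM ?posrE // lnM ?posrE ?exprn_gt0 //.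
    by rewrite (lnXn 3 r0) (lnXn 2 d0); ring.
  have : ln (1 + 29) <= 29 :> R by apply: le_ln1Dx; lra.
  have : ln e <= 0 by exact: ln_le0.
  have : ln r <= 0 by exact: ln_le0.
  have : ln d <= 0 by exact: ln_le0.
  by rewrite /L; lra.
exists k.*2; split.
  have kl : k%:R <= 16 / q * l + 1.
    rewrite /k -natr1 lerD2r.
    have : 0 <= 16 / q * l by rewrite mulr_ge0 ?divr_ge0 ?(ltW q0).
    by case/truncn_itv/andP.
  (* In this case [e * r * d < 3 / 4] keeps [L] away from 0, so additive constants are multiples of
     [L]. *)
  have L4 : 1 / 4 <= L by apply: le_trans L_ge; lra.
  apply: le_trans (_ : 4000 * (q^-1 * L) <= _); last first.
    by rewrite ler_wpM2l // ler_wpM2r.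
  have qi1 : 1 <= q^-1 by rewrite invf_ge1.
  rewrite -muln2 natrM.
  have h1 : q^-1 * l <= q^-1 * (119 * L) by rewrite ler_wpM2l //; lra.
  have h2 : 1 <= 4 * (q^-1 * L) by nra.
  lra.
move=> A; rewrite /A err.
have -> : e = \sum_j v ord0 j * e by rewrite -mulr_suml vs mul1r.
apply: ler_sum => j _; rewrite ler_wpM2l ?(ltW (v0 j)) //.
apply: (sk_col_marginal_rate (r := r) (gr := g) (gc := g')) => //.
rewrite -/d -/q.
apply: geometric_decay; rewrite ?divr_gt0 //; first by lra.
have -> : q / 16 * k%:R = k%:R / (16 / q) by field; rewrite gt_eqF.
rewrite ler_pdivlMr ?divr_gt0 // mulrC -/l ltW //.
exact: truncnS_gt.
Qed.
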